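(* Let $n\ge4$ with $n\equiv0\pmod4$, and let the eigenspaces of the cycle graph $C_n$ be in frequency order. Then every minimal (arbitrarily weighted) extremal design of $C_n$ is positively weighted.
   Context: $C_n$ is the cycle graph on $n$ vertices. For a connected $\delta$-regular graph $G$ on $n$ vertices with adjacency matrix $A$, eigenvalues and eigenspaces mean those of $\frac1\delta A$. Frequency order means that eigenspaces $\Lambda_1<\cdots<\Lambda_m$ are ordered by decreasing absolute value of the eigenvalue, with $\Lambda_1=\operatorname{span}\{\mathbb{1}\}$ (eigenvalue $1$) first. A vertex subset $W$ with real weights $(a_w)_{w\in W}$ averages an eigenspace $\Lambda$ if $\sum_{w\in W}a_w\phi(w)=\frac1n\sum_{v}\phi(v)$ for all $\phi\in\Lambda$. $W$ is a (weighted) extremal design if there are weights $a_w\in\mathbb{R}$ with which $W$ averages all eigenspaces except the last one; it is positively weighted if this is possible with all $a_w>0$. Minimal means inclusion-minimal among weighted extremal designs. *)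

(* Defs.v *)
From mathcomp Require Import all_boot all_order all_algebra.
From mathcomp Require Import reals.

Set Implicit Arguments.
Unset Strict Implicit.
Unset Printing Implicit Defensive.

Import Order.TTheory GRing.Theory Num.Theory.
Local Open Scope ring_scope.

(* A graph on n vertices is a symmetric irreflexive relation on 'I_n. *)
Definition regular (n delta : nat) (e : rel 'I_n) : Prop :=
  forall v, #|[set u | e v u]| = delta.

Definition connected (n : nat) (e : rel 'I_n) : Prop :=
  forall u v, connect e u v.

(* ordS is the cyclic successor; this is irreflexive and 2-regular only for
   n >= 3. *)
Definition cycle_graph (n : nat) : rel 'I_n :=
  [rel i j | (j == ordS i) || (i == ordS j)].

Definition adjmx (R : realType) (n : nat) (e : rel 'I_n) : 'M[R]_n :=
  \matrix_(i, j) (e i j)%:R.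

Definition normalized_adjmx (R : realType) (n delta : nat) (e : rel 'I_n) :
    'M[R]_n :=
  delta%:R^-1 *: adjmx R e.

(* An ordering of the eigenspaces of A is given by the corresponding ordering
   of its distinct eigenvalues. Ties in absolute value are broken arbitrarily,
   except that the eigenvalue 1 comes first even if -1 is an eigenvalue. *)
Definition frequency_order (R : realType) (n : nat) (A : 'M[R]_n)
    (s : seq R) : Prop :=
  [/\ uniq s,
      (forall mu, (mu \in s) = eigenvalue A mu),
      sorted (fun x y => `|y| <= `|x|) s
    & head 0 s = 1].

(* Functions on the vertices are row vectors, and L stands for its row space;
   eigenspace A mu consists of the row vectors with phi *m A = mu *: phi, which
   is the usual eigenspace as A is symmetric. *)
Definition averages (R : realType) (n : nat) (W : {set 'I_n})
    (a : 'I_n -> R) (L : 'M[R]_n) : Prop :=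
  forall phi : 'rV[R]_n, (phi <= L)%MS ->
    \sum_(w in W) a w * phi 0 w = n%:R^-1 * \sum_v phi 0 v.

Definition averages_all_but_last (R : realType) (n : nat) (A : 'M[R]_n)
    (s : seq R) (W : {set 'I_n}) (a : 'I_n -> R) : Prop :=
  forall mu, mu \in take (size s).-1 s -> averages W a (eigenspace A mu).

(* Only the values of the weights a on W matter; they may vanish. *)
Definition extremal_design (R : realType) (n : nat) (A : 'M[R]_n)
    (s : seq R) (W : {set 'I_n}) : Prop :=
  exists a : 'I_n -> R, averages_all_but_last A s W a.

Definition positively_weighted (R : realType) (n : nat) (A : 'M[R]_n)
    (s : seq R) (W : {set 'I_n}) : Prop :=
  exists2 a : 'I_n -> R,
    (forall w, w \in W -> 0 < a w) & averages_all_but_last A s W a.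

Definition minimal_extremal_design (R : realType) (n : nat) (A : 'M[R]_n)
    (s : seq R) (W : {set 'I_n}) : Prop :=
  extremal_design A s W /\
  (forall W' : {set 'I_n}, extremal_design A s W' -> W' \subset W -> W' = W).

Lemma val_ordS n (i : 'I_n) :
  ordS i = (if i.+1 == n then 0 else i.+1)%N :> nat.
Proof.
rewrite /=; case: eqP => [->|/eqP ne]; first by rewrite modnn.
by rewrite modn_small // ltn_neqAle ne ltn_ord.
Qed.

Lemma cycle_graph_sym n : symmetric (@cycle_graph n).
Proof. by move=> i j; exact: orbC. Qed.

Lemma cycle_graph_irr n : (2 < n)%N -> irreflexive (@cycle_graph n).
Proof.
move=> n2 i; apply/negP => /orP i_i.
have /(congr1 val) /= h : i = ordS i by case: i_i => /eqP.
have := val_ordS i; rewrite /= -h; case: eqP => [e i0|_ e].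
  by rewrite -e i0 in n2.
by have := ltnn i; rewrite {2}e ltnSn.
Qed.

Lemma cycle_graph_regular n : (2 < n)%N -> regular 2 (@cycle_graph n).
Proof.
move=> n2 v.
have -> : [set u | @cycle_graph n v u] = [set ordS v; ord_pred v].
  apply/setP => u; rewrite !inE /=; congr (_ || _).
  by apply/eqP/eqP => [->|->]; rewrite ?ordSK ?ord_predK.
rewrite cards2; suff -> : ordS v != ord_pred v by [].
apply/negP => /eqP/(congr1 (@ordS n)); rewrite ord_predK => /(congr1 val) /= h.
have := val_ordS (ordS v); rewrite [val (ordS (ordS v))]h val_ordS.
case: (eqVneq v.+1 n) => [e|_].
  case: eqP => [e1|_ v1]; first by rewrite -e1 in n2.
  by rewrite -e v1 in n2.
case: (eqVneq v.+2 n) => [e v0|_ e]; first by rewrite -e v0 in n2.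
by have := ltnn v; rewrite {2}e leqW.
Qed.

Lemma cycle_graph_connected n : connected (@cycle_graph n).
Proof.
case: n => [[]//|n] u v.
have h (k : 'I_n.+1) : connect (@cycle_graph n.+1) ord0 k.
  case: k => k; elim: k => [|k IH] lt_k.
    by apply: eq_connect0; apply: val_inj.
  apply: connect_trans (IH (ltnW lt_k)) (connect1 _).
  apply/orP; left; apply/eqP/val_inj.
  by rewrite /= modn_small.
by apply: connect_trans (h v); rewrite (sym_connect_sym (@cycle_graph_sym _)); exact: h.
Qed.

(* Main.v *)
Require Import Defs.
From mathcomp Require Import all_boot all_order all_algebra.
From mathcomp Require Import reals.
From mathcomp Require Import spectral.
From mathcomp.real_closed Require Import complex.
From mathcomp Require Import ring zify.

(** Call [a] extended by zero off [W], minus the constant [1/n], the deviation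
    of the weighted set [(W, a)]. A function is averaged by [(W, a)] when the
    deviation is orthogonal to it. Since [n] is divisible by 4, the
    walk matrix of the cycle has eigenvalue 0, which has the least absolute
    value and therefore ends every frequency order. So an extremal design is a
    weighted set whose deviation is orthogonal to all eigenspaces of nonzero
    eigenvalue; by the spectral theorem this says that the deviation [psi] is
    in the kernel of the walk matrix ([averages_all_but_lastP]), that is,
    [psi (v - 1) + psi (v + 1) = 0] for all [v] ([cycle_kernelP]).

    The signs of such a [psi] alternate along steps of length two. Hence the
    set [H] of all vertices where [psi] is positive, completed, where [psi]
    vanishes, by the pattern ++-- of period four, contains exactly one of
    [v - 1] and [v + 1] for every [v]. The constant weight [2/n] on [H] has
    deviation [1/n] on [H] and [-1/n] off [H], which is again in the kernel,
    so [H] is a positively weighted design. Off [W], [psi] is [-1/n],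
    which is negative, so [H] is contained in [W]; if [W] is minimal, then
    [W = H]. *)

Set Implicit Arguments.
Unset Strict Implicit.
Unset Printing Implicit Defensive.

Import Order.TTheory GRing.Theory Num.Theory.

Local Open Scope ring_scope.

(** * Kernels of symmetric matrices *)

(** The eigenvectors given by the spectral theorem over the complex closure
    have real eigenvalues, so that their real and imaginary parts are real
    eigenvectors. *)
Lemma symmetric_mulmx_eq0 (R : rcfType) (n : nat) (A : 'M[R]_n) (x : 'rV[R]_n) :
    A^T = A ->
    (forall mu (phi : 'rV[R]_n), mu != 0 -> phi *m A = mu *: phi ->
       \sum_i x 0 i * phi 0 i = 0) ->
  x *m A = 0.
Proof.
move=> A_sym x_orth; pose toC := real_complex R; pose B := map_mx toC A.
have B_herm : B \is hermsymmx.
  apply: realsym_hermsym.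
    by apply/is_hermitianmxP; rewrite expr0 scale1r map_mx_id // map_trmx A_sym.
  by apply/mxOverP => i j; rewrite mxE; apply/complex_realP; exists (A i j).
have /orthomx_spectralP := hermitian_normalmx B_herm.
have d_real := hermitian_spectral_diag_real B_herm.
have P_unit := spectral_unit B.
move: (spectralmx B) (spectral_diag B) P_unit d_real => P d P_unit d_real B_eq.
have PB : P *m B = diag_mx d *m P by rewrite B_eq !mulmxA mulmxV // mul1mx.
have x_row i : d 0 i != 0 -> \sum_j toC (x 0 j) * P i j = 0.
  have /complex_realP[k dk] := mxOverP d_real 0 i.
  rewrite dk => k_neq0.
  have {}k_neq0 : k != 0 by apply: contraNneq k_neq0 => ->.
  pose parts (f : R[i] -> R) : 'rV[R]_n := \row_j f (P i j).
  have row_eq j : \sum_l P i l * toC (A l j) = toC k * P i j.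
    have /matrixP/(_ i j) := PB; rewrite mul_diag_mx !mxE dk => <-.
    by apply: eq_bigr => l _; rewrite mxE.
  have Re_eig : parts (@complex.Re R) *m A = k *: parts (@complex.Re R).
    apply/rowP => j; rewrite !mxE; have /(congr1 (@complex.Re R)) := row_eq j.
    rewrite (raddf_sum (@complex.Re R : Rcomplex R -> R)).
    case: (P i j) => p q /=; rewrite mul0r subr0 => <-.
    by apply: eq_bigr => l _; rewrite mxE; case: (P i l) => u v /=; ring.
  have Im_eig : parts (@complex.Im R) *m A = k *: parts (@complex.Im R).
    apply/rowP => j; rewrite !mxE; have /(congr1 (@complex.Im R)) := row_eq j.
    rewrite (raddf_sum (@complex.Im R : Rcomplex R -> R)).
    case: (P i j) => p q /=; rewrite mul0r addr0 => <-.
    by apply: eq_bigr => l _; rewrite mxE; case: (P i l) => u v /=; ring.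
  apply/eqP; rewrite eq_complex; apply/andP; split; apply/eqP.
    rewrite (raddf_sum (@complex.Re R : Rcomplex R -> R)) /=.
    rewrite -[RHS](x_orth _ _ k_neq0 Re_eig); apply: eq_bigr => l _.
    by rewrite mxE; case: (P i l) => u v /=; ring.
  rewrite (raddf_sum (@complex.Im R : Rcomplex R -> R)) /=.
  rewrite -[RHS](x_orth _ _ k_neq0 Im_eig); apply: eq_bigr => l _.
  by rewrite mxE; case: (P i l) => u v /=; ring.
(* As B is symmetric, applying it before pairing with the i-th eigenvector
   multiplies the pairing by d_i; either d_i is 0 or the pairing is. *)
have xBP : map_mx toC x *m B *m P^T = 0.
  have BT : B^T = B by rewrite /B map_trmx A_sym.
  rewrite -mulmxA -BT -trmx_mul PB trmx_mul tr_diag_mx mulmxA mul_mx_diag.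
  apply/rowP => i; rewrite !mxE.
  have [->|di] := eqVneq (d 0 i) 0; first by rewrite mulr0.
  rewrite -[X in X * _ = _](_ : 0 = _) ?mul0r // -[LHS](x_row i di).
  by apply: eq_bigr => j _; rewrite !mxE.
have xB : map_mx toC x *m B = 0.
  have PT_unit : P^T \in unitmx by rewrite unitmx_tr.
  by rewrite -[LHS](mulmxK PT_unit) xBP mul0mx.
by apply/eqP; rewrite -(map_mx_eq0 toC) map_mxM; apply/eqP.
Qed.

Lemma symmetric_orthogonal_kernel (R : numFieldType) (n : nat) (A : 'M[R]_n)
    (x phi : 'rV[R]_n) (mu : R) :
    A^T = A -> x *m A = 0 -> mu != 0 -> phi *m A = mu *: phi ->
  \sum_i x 0 i * phi 0 i = 0.
Proof.
move=> A_sym xA mu_neq0 phi_eig.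
have : phi *m A *m x^T = 0.
  by rewrite -mulmxA -{1}A_sym -trmx_mul xA trmx0 mulmx0.
rewrite phi_eig -scalemxAl => /eqP; rewrite scaler_eq0 (negPf mu_neq0) /=.
move=> /eqP/matrixP/(_ 0 0); rewrite !mxE => sum0; rewrite -[RHS]sum0.
by apply: eq_bigr => i _; rewrite mxE mulrC.
Qed.

(** * Designs and deviations *)

(** No eigenvalue other than 0 can follow 0 when absolute values decrease, so
    0 is the last one, and dropping the last one drops exactly 0. *)
Lemma frequency_order_all_but_last (R : realType) (n : nat) (A : 'M[R]_n)
    (s : seq R) :
  frequency_order A s -> eigenvalue A 0 ->
  forall mu, (mu \in take (size s).-1 s) = (mu != 0) && eigenvalue A mu.
Proof.
case=> s_uniq s_eig s_sorted _; rewrite -s_eig => s0 mu.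
rewrite -s_eig; case/lastP: s s_uniq s_sorted s0 {s_eig} => [|s x] //.
rewrite rcons_uniq => /andP[xs _] s_sorted s0.
have x0 : x = 0.
  move: s0 s_sorted; rewrite mem_rcons inE => /predU1P[->//|].
  case/splitPr => p q; rewrite rcons_cat /= => pq_sorted.
  have := cat_sorted2 pq_sorted => -[_].
  have abs_trans : transitive (fun y z : R => `|z| <= `|y|).
    by move=> y z t zy ty; apply: le_trans ty zy.
  move=> /(order_path_min abs_trans); rewrite all_rcons normr0 normr_le0.
  by case/andP=> /eqP.
rewrite size_rcons /= -cats1 take_size_cat // mem_cat inE x0.
by case: eqVneq => [->|_]; rewrite ?orbF // -x0 (negPf xs).
Qed.

Definition deviation (R : realType) (n : nat) (W : {set 'I_n}) (a : 'I_n -> R) :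
    'rV[R]_n :=
  \row_v ((if v \in W then a v else 0) - n%:R^-1).

Lemma averagesE (R : realType) (n : nat) (W : {set 'I_n}) (a : 'I_n -> R)
    (L : 'M[R]_n) :
  averages W a L <-> (forall phi : 'rV[R]_n, (phi <= L)%MS ->
                        \sum_v deviation W a 0 v * phi 0 v = 0).
Proof.
have devE (phi : 'rV[R]_n) : \sum_v deviation W a 0 v * phi 0 v =
    \sum_(w in W) a w * phi 0 w - n%:R^-1 * \sum_v phi 0 v.
  rewrite mulr_sumr [X in X - _]big_mkcond -sumrB; apply: eq_bigr => v _.
  by rewrite mxE mulrBl; case: ifP => // _; rewrite mul0r.
split=> av phi /av; rewrite devE; last exact: subr0_eq.
by move=> ->; rewrite subrr.
Qed.

Lemma averages_all_but_lastP (R : realType) (n : nat) (A : 'M[R]_n)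
    (s : seq R) (W : {set 'I_n}) (a : 'I_n -> R) :
    A^T = A -> frequency_order A s -> eigenvalue A 0 ->
  averages_all_but_last A s W a <-> deviation W a *m A = 0.
Proof.
move=> A_sym s_freq A0; have sE := frequency_order_all_but_last s_freq A0.
split=> [design|dev_ker mu].
  apply: symmetric_mulmx_eq0 => // mu phi mu_neq0 phi_eig.
  have [->|phi_neq0] := eqVneq phi 0.
    by apply: big1 => i _; rewrite [X in _ * X]mxE mulr0.
  have mu_eig : eigenvalue A mu by apply/eigenvalueP; exists phi.
  have /design/averagesE : mu \in take (size s).-1 s by rewrite sE mu_neq0.
  by apply; apply/eigenspaceP.
rewrite sE => /andP[mu_neq0 _]; apply/averagesE => phi /eigenspaceP phi_eig.
exact: symmetric_orthogonal_kernel phi_eig.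
Qed.

(** * Kernel vectors on the cycle *)

Lemma cycle_kernelP (R : realType) (n : nat) (psi : 'rV[R]_n) : (2 < n)%N ->
  psi *m normalized_adjmx R 2 (@cycle_graph n) = 0 <->
  (forall v, psi 0 (ordS v) + psi 0 (ord_pred v) = 0).
Proof.
move=> n_gt2.
have nbrs (v u : 'I_n) : cycle_graph u v = (u \in [set ordS v; ord_pred v]).
  rewrite !inE /= orbC; congr (_ || _).
  by apply/eqP/eqP => ->; rewrite ?ordSK ?ord_predK.
have nbrs_neq (v : 'I_n) : ordS v != ord_pred v.
  have := cycle_graph_regular n_gt2 v.
  have -> : [set u | cycle_graph v u] = [set ordS v; ord_pred v].
    by apply/setP => u; rewrite inE cycle_graph_sym nbrs.
  by rewrite cards2; case: eqP.
have mulE v : (psi *m normalized_adjmx R 2 (@cycle_graph n)) 0 v =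
    2^-1 * (psi 0 (ordS v) + psi 0 (ord_pred v)).
  rewrite -scalemxAr mxE; congr (_ * _).
  transitivity (\sum_(u in [set ordS v; ord_pred v]) psi 0 u).
    rewrite mxE [RHS]big_mkcond; apply: eq_bigr => u _.
    by rewrite mxE nbrs; case: ifP; rewrite ?mulr1 ?mulr0.
  by rewrite big_setU1 ?inE ?nbrs_neq //= big_set1.
split=> [/matrixP psi_ker v | psi_alt].
  have /eqP := psi_ker 0 v; rewrite mulE mxE mulf_eq0 invr_eq0.
  by rewrite pnatr_eq0 => /eqP.
by apply/rowP => v; rewrite mulE psi_alt mulr0 mxE.
Qed.

(** Any rule for the zeros of [psi] that differs between [v - 1] and [v + 1]
    would do; the residues modulo 4 give one, since [n] is divisible by 4. *)
Definition nonneg_half (R : realType) (n : nat) (psi : 'rV[R]_n) : {set 'I_n} :=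
  [set v | (0 < psi 0 v) || (psi 0 v == 0) && (v %% 4 < 2)%N].

Lemma nonneg_half_alternates (R : realType) (n : nat) (psi : 'rV[R]_n)
    (v : 'I_n) :
    (4 %| n)%N -> psi 0 (ordS v) + psi 0 (ord_pred v) = 0 ->
  (ordS v \in nonneg_half psi) = (ord_pred v \notin nonneg_half psi).
Proof.
move=> n_dvd4 /eqP; rewrite addr_eq0 => /eqP psi_alt.
have pattern : (ordS v %% 4 < 2)%N = ~~ (ord_pred v %% 4 < 2)%N.
  by rewrite /= !modn_dvdm //; have := ltn_ord v; lia.
rewrite !inE psi_alt pattern oppr_gt0 oppr_eq0.
by case: ltgtP.
Qed.

(** The neighbours of each vertex have the deviations [1/n] and [-1/n], in some
    order. This kernel vector gives both the design that replaces [W] and, for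
    [psi = 0], an eigenvector of eigenvalue 0. *)
Lemma deviation_nonneg_half (R : realType) (n : nat) (psi : 'rV[R]_n) :
    (2 < n)%N -> (4 %| n)%N ->
    psi *m normalized_adjmx R 2 (@cycle_graph n) = 0 ->
  deviation (nonneg_half psi) (fun=> 2 / n%:R)
    *m normalized_adjmx R 2 (@cycle_graph n) = 0.
Proof.
move=> n_gt2 n_dvd4 /(cycle_kernelP _ n_gt2) psi_ker.
apply/cycle_kernelP => // v; rewrite !mxE.
rewrite (nonneg_half_alternates n_dvd4 (psi_ker v)).
by case: (ord_pred v \in _) => /=; ring.
Qed.

Lemma cycle_eigenvalue0 (R : realType) (n : nat) : (2 < n)%N -> (4 %| n)%N ->
  eigenvalue (normalized_adjmx R 2 (@cycle_graph n)) 0.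
Proof.
move=> n_gt2 n_dvd4; apply/eigenvalueP.
exists (deviation (nonneg_half (0 : 'rV[R]_n)) (fun=> 2 / n%:R)).
  by rewrite scale0r deviation_nonneg_half // mul0mx.
have n_gt0 : (0 < n)%N by lia.
have ninv : n%:R^-1 != 0 :> R by rewrite invr_eq0 pnatr_eq0 -lt0n.
apply/eqP => /rowP/(_ (Ordinal n_gt0)); rewrite !mxE inE mxE eqxx orbT.
by move=> dev0; case/eqP: ninv; rewrite -dev0; ring.
Qed.

Lemma trmx_normalized_adjmx (R : realType) (n delta : nat) (e : rel 'I_n) :
  symmetric e -> (normalized_adjmx R delta e)^T = normalized_adjmx R delta e.
Proof. by move=> e_sym; apply/matrixP => i j; rewrite !mxE e_sym. Qed.

Theorem corollary4p5 (R : realType) (n : nat) (n_ge4 : (4 <= n)%N)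
    (n_mod4 : n = 0 %[mod 4]) (s : seq R)
    (s_freq : frequency_order (normalized_adjmx R 2 (@cycle_graph n)) s)
    (W : {set 'I_n}) :
  minimal_extremal_design (normalized_adjmx R 2 (@cycle_graph n)) s W ->
  positively_weighted (normalized_adjmx R 2 (@cycle_graph n)) s W.
Proof.
have n_gt2 : (2 < n)%N by lia.
have n_dvd4 : (4 %| n)%N by apply/eqP; rewrite n_mod4.
have designP W' a := averages_all_but_lastP W' a
  (trmx_normalized_adjmx R 2 (@cycle_graph_sym n)) s_freq
  (cycle_eigenvalue0 R n_gt2 n_dvd4).
have ninv_gt0 : 0 < n%:R^-1 :> R by rewrite invr_gt0 ltr0n; lia.
case=> -[a /designP dev_ker] W_min; set psi := deviation W a in dev_ker.
have H_design := deviation_nonneg_half n_gt2 n_dvd4 dev_ker.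
have H_sub : nonneg_half psi \subset W.
  apply/subsetP => v; rewrite inE mxE; case: ifP => // _.
  by rewrite sub0r oppr_gt0 oppr_eq0 ltNge (ltW ninv_gt0) gt_eqF.
have <- : nonneg_half psi = W.
  by apply: W_min => //; exists (fun=> 2 / n%:R); apply/designP.
exists (fun=> 2 / n%:R); last exact/designP.
by move=> w _; rewrite mulr_gt0.
Qed.
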